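(* Let $X$ be a Souslin space (for example a Polish space), and let $\mathcal{F}$ be a countable set of bounded, measurable $\mathbb{C}$-valued functions on $X$. Assume that (S.1) $\mathcal{F}$ is multiplicatively closed and closed under complex conjugation; (S.2) $\mathcal{F}$ separates points of $X$; (S.3) $\mathcal{F}$ vanishes nowhere, i.e. for every $x\in X$ there exists $f_x\in\mathcal{F}$ with $f_x(x)\neq 0$. Then $\mathcal{F}$ is separating for measures in $\mathcal{M}_{\mathcal{F}}(X)$, i.e. whenever $\mu_1,\mu_2\in\mathcal{M}_{\mathcal{F}}(X)$ satisfy $\int f\,d\mu_1=\int f\,d\mu_2$ for all $f\in\mathcal{F}$, then $\mu_1=\mu_2$.
   Context: A Souslin space is a Hausdorff topological space $X$ for which there exist a Polish space $Y$ and a continuous surjective map $Y\to X$. Measurability and measures refer to the Borel $\sigma$-field of $X$; $\mathcal{M}(X)$ is the set of (non-negative, possibly infinite) measures on it, and $\mathcal{M}_{\mathcal{F}}(X)=\{\mu\in\mathcal{M}(X): \int|f|\,d\mu<\infty\ \forall f\in\mathcal{F}\}$. ''Multiplicatively closed'' means $f,g\in\mathcal{F}$ implies $fg\in\mathcal{F}$. *)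

(* Defs.v *)
From HB Require Import structures.
From mathcomp Require Import all_boot all_order all_algebra.
From mathcomp Require Import all_classical all_reals all_analysis.
From mathcomp Require Import complex.
Set Implicit Arguments.
Unset Strict Implicit.
Unset Printing Implicit Defensive.
Import Order.TTheory GRing.Theory Num.Theory.
Import numFieldNormedType.Exports.
Local Open Scope classical_set_scope.
Local Open Scope ring_scope.
Local Open Scope complex_scope.

Notation borelType T := (g_sigma_algebraType (@open T)).

Definition complete_metric (R : realType) (M : metricType R) : Prop :=
  forall u : nat -> M, cauchy (u @ \oo) -> exists l : M, u @ \oo --> l.

Definition separable (T : topologicalType) : Prop :=
  exists2 S : set T, countable S & dense S.

Definition homeomorphism (S T : topologicalType) (f : S -> T) : Prop :=
  exists g : T -> S, [/\ cancel f g, cancel g f, continuous f & continuous g].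

Definition completely_metrizable (R : realType) (T : topologicalType) : Prop :=
  exists M : metricType R,
    complete_metric M /\ exists f : M -> T, homeomorphism f.

Definition polish_space (R : realType) (T : topologicalType) : Prop :=
  separable T /\ completely_metrizable R T.

Definition souslin_space (R : realType) (X : topologicalType) : Prop :=
  hausdorff_space X /\
  exists (Y : topologicalType) (h : Y -> X),
    [/\ polish_space R Y, continuous h & range h = [set: X]].

(* X is pointed because a measurableType is: it is a nonempty space. *)
Section complex_functions.
Context {R : realType} {X : ptopologicalType}.
Implicit Types (F : set (X -> R[i])) (f : X -> R[i]).
Implicit Types mu : {measure set (borelType X) -> \bar R}.

Definition cmodulus (z : R[i]) : R := ComplexField.Normc.normc z.

(* (R[i])^o carries the topology of the modulus. *)
Definition borel_measurable f : Prop :=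
  measurable_fun [set: borelType X]
    (f : borelType X -> borelType (R[i])^o).

Definition cbounded f : Prop := exists M : R, forall x, cmodulus (f x) <= M.

Definition cintegral mu f : R[i] :=
  (\int[mu]_x complex.Re (f x)) +i* (\int[mu]_x complex.Im (f x)).

Definition measures_of F : set {measure set (borelType X) -> \bar R} :=
  [set mu : {measure set (borelType X) -> \bar R} | forall f, F f ->
    (\int[mu]_x (cmodulus (f x))%:E < +oo)%E].

Definition mul_closed F : Prop :=
  forall f g, F f -> F g -> F (fun x => f x * g x).

Definition conj_closed F : Prop := forall f, F f -> F (fun x => (f x)^*).

Definition separates_points F : Prop :=
  forall x y : X, x <> y -> exists2 f, F f & f x <> f y.

Definition vanishes_nowhere F : Prop :=
  forall x : X, exists2 f, F f & f x <> 0.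

(* A measure is a function on all subsets, unconstrained outside the sigma-field:
   equality of measures is equality on measurable sets. *)
Definition separating_for F
    (M : set {measure set (borelType X) -> \bar R}) : Prop :=
  forall mu1 mu2, M mu1 -> M mu2 ->
    (forall f, F f -> cintegral mu1 f = cintegral mu2 f) ->
    forall A : set (borelType X), measurable A -> mu1 A = mu2 A.

End complex_functions.

(* Main.v *)
(* Two facts combine.

   Algebra side: let A be the class of bounded real functions obtained from the
   constants and the real and imaginary parts of members of F by linear
   combinations and bounded pointwise limits.  For g in F the function |g|^2 =
   g * conj g lies in F, hence is integrable, and dominated convergence gives
   that u |g|^2 has the same integral under both measures for every u in A.  As
   F is multiplicatively closed, A is an algebra, so the sets with indicator in
   A form a sigma-algebra, which contains all sets {u > 0} with u in A.

   Topological side (Blackwell): on a Souslin space a sigma-algebra containing a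
   separating sequence of Borel sets contains every Borel set.  This is Lusin's
   separation of a Borel set from its complement, both being continuous images
   of closed subsets of the Baire space, once the parametrizations are refined
   so that the sequence becomes clopen.

   Hence the indicators of all Borel sets B lie in A; dividing out the weight
   |g|^2 shows that both measures agree on B inside {g <> 0}, and countably many
   of the sets {g <> 0} cover X. *)
Require Import Defs.
From mathcomp Require Import all_boot all_order all_algebra.
From mathcomp Require Import all_classical all_reals all_analysis.
From mathcomp Require Import measurable_realfun complex ring lra.
Set Implicit Arguments.
Unset Strict Implicit.
Unset Printing Implicit Defensive.
Import Order.TTheory GRing.Theory Num.Theory.
Import numFieldNormedType.Exports.
Local Open Scope classical_set_scope.

(** * Analytic sets and Lusin separation *)

Definition agree (m : nat) (x y : nat -> nat) : Prop :=
  forall i, (i < m)%N -> x i = y i.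

Lemma agreeW m n x y : (m <= n)%N -> agree n x y -> agree m x y.
Proof. by move=> mn xy i im; apply: xy; exact: leq_trans im mn. Qed.

Lemma agree_sym m x y : agree m x y -> agree m y x.
Proof. by move=> xy i im; rewrite xy. Qed.

Lemma agree_trans m y x z : agree m x y -> agree m y z -> agree m x z.
Proof. by move=> xy yz i im; rewrite xy// yz. Qed.

(* Closedness in the Baire space and continuity on C are spelled out through
   finite prefixes; O plays the role of a subbase of the topology of X. *)
Definition analytic {X : Type} (O : set (set X)) (E : set X) : Prop :=
  exists (C : set (nat -> nat)) (p : (nat -> nat) -> X),
  [/\ forall x, (forall m, exists2 y, C y & agree m x y) -> C x,
      p @` C = E &
      forall x V, C x -> O V -> V (p x) ->
        exists m, forall y, C y -> agree m x y -> V (p y)].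

Definition hausdorff_family {X : Type} (O : set (set X)) : Prop :=
  forall x y, x <> y -> exists U V,
    [/\ O U, O V, U x, V y & forall z, U z -> ~ V z].

Section analytic_sets.
Context {X : Type}.
Implicit Types (O : set (set X)) (E : set X).

(** [B] is constant on [E], so the same parametrization is still continuous for the larger family,
    with the empty prefix as witness. *)
Lemma analytic_refine O E B : analytic O E -> E `<=` B \/ E `<=` ~` B ->
  analytic (O `|` [set B; ~` B]) E.
Proof.
move=> [C [p [cC imp cp]]] EB; exists C, p; split=> // x V Cx.
have Ep y : C y -> E (p y) by move=> Cy; rewrite -imp; exists y.
case=> [OV|]; first exact: cp.
have Epx := Ep _ Cx.
by case=> ->; case: EB => EB Vpx; exists 0%N => y Cy _ /=;
  have := EB _ (Ep _ Cy); have := EB _ Epx.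
Qed.

(** The first entry of a sequence selects the index [n], and the remaining entries feed the
    parametrization of [E n]. *)
Lemma analytic_bigcup O (E : nat -> set X) :
  (forall n, analytic O (E n)) -> analytic O (\bigcup_n E n).
Proof.
pose prop (n : nat) (Cp : set (nat -> nat) * ((nat -> nat) -> X)) :=
  [/\ forall x, (forall m, exists2 y, Cp.1 y & agree m x y) -> Cp.1 x,
      Cp.2 @` Cp.1 = E n &
      forall x V, Cp.1 x -> O V -> V (Cp.2 x) ->
        exists m, forall y, Cp.1 y -> agree m x y -> V (Cp.2 y)].
move=> aE; have {aE} : forall n, exists Cp, prop n Cp.
  by move=> n; have [C [p h]] := aE n; exists (C, p).
move=> /choice [Cp hCp].
pose tl (z : nat -> nat) i := z i.+1.
exists [set z | (Cp (z 0%N)).1 (tl z)], (fun z => (Cp (z 0%N)).2 (tl z)).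
split=> /=.
- move=> x hx; have [+ _ _] := hCp (x 0%N); apply=> m.
  have [y Cy xy] := hx m.+1; exists (tl y); first by rewrite xy.
  by move=> i im; apply: xy.
- apply/seteqP; split=> [_ [z Cz <-]|x [n _]].
    by exists (z 0%N) => //; have [_ <- _] := hCp (z 0%N); exists (tl z).
  have [_ <- _] := hCp n => -[z Cz <-].
  by exists (fun i => if i is j.+1 then z j else n).
- move=> x V Cx OV Vx; have [_ _ cp] := hCp (x 0%N).
  have [m hm] := cp _ _ Cx OV Vx; exists m.+1 => y Cy xy.
  have e : y 0%N = x 0%N by rewrite xy.
  rewrite e in Cy *; apply: hm => // i im; exact: xy.
Qed.

(** Coordinate [n] of [z], once the Baire space is identified with its own countable power by coding
    pairs. *)
Let slice (n : nat) (z : nat -> nat) (i : nat) := z (pickle (n, i)).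

Let agree_slice n m : exists M, forall x y, agree M x y ->
  agree m (slice n x) (slice n y).
Proof.
elim: m => [|m [M hM]]; first by exists 0%N.
exists (maxn M (@pickle (nat * nat)%type (n, m)).+1) => x y xy i.
rewrite ltnS leq_eqVlt.
move=> /predU1P[->|im].
  by apply: xy; rewrite leq_max leqnn orbT.
by apply: hM im; apply: agreeW xy; exact: leq_maxl.
Qed.

(* The fibre product of the parametrizations of the E n, inside the countable
   power of the Baire space, parametrizes the intersection. *)
Lemma analytic_bigcap O0 (O : nat -> set (set X)) (E : nat -> set X) :
  hausdorff_family O0 -> (forall n, O0 `<=` O n) ->
  (forall n, analytic (O n) (E n)) ->
  analytic (\bigcup_n O n) (\bigcap_n E n).
Proof.
pose prop (n : nat) (Cp : set (nat -> nat) * ((nat -> nat) -> X)) :=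
  [/\ forall x, (forall m, exists2 y, Cp.1 y & agree m x y) -> Cp.1 x,
      Cp.2 @` Cp.1 = E n &
      forall x V, Cp.1 x -> O n V -> V (Cp.2 x) ->
        exists m, forall y, Cp.1 y -> agree m x y -> V (Cp.2 y)].
move=> hO O0O aE; have {aE} : forall n, exists Cp, prop n Cp.
  by move=> n; have [C [p h]] := aE n; exists (C, p).
move=> /choice [Cp hCp].
pose C n := (Cp n).1; pose p n := (Cp n).2.
exists [set z | forall n, C n (slice n z) /\
                          p n (slice n z) = p 0%N (slice 0%N z)].
exists (fun z => p 0%N (slice 0%N z)); split=> /=.
- move=> x hx; have Cx n : C n (slice n x).
    have [+ _ _] := hCp n; apply=> m; have [M hM] := agree_slice n m.
    have [y Zy xy] := hx M; exists (slice n y); last exact: hM.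
    by have [] := Zy n.
  (* If two values at [x] differed, disjoint [U] and [V] would separate them. By continuity, a
     nearby point [y] of the fibre product would then have its common value in both. *)
  move=> n; split=> //; apply: contrapT => /hO [U [V [OU OV Ux Vx UV]]].
  have [_ _ /(_ _ U (Cx n) (O0O n _ OU) Ux)[m1 h1]] := hCp n.
  have [_ _ /(_ _ V (Cx 0%N) (O0O 0%N _ OV) Vx)[m2 h2]] := hCp 0%N.
  have [M1 hM1] := agree_slice n m1; have [M2 hM2] := agree_slice 0%N m2.
  have [y Zy xy] := hx (maxn M1 M2).
  have [Cy ey] := Zy n; have [Cy0 _] := Zy 0%N.
  apply: (UV (p n (slice n y))).
    by apply: h1 => //; apply/hM1; apply: agreeW xy; exact: leq_maxl.
  rewrite ey; apply: h2 => //; apply/hM2; apply: agreeW xy; exact: leq_maxr.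
- apply/seteqP; split=> [_ [z Zz <-] n _|x Ex].
    by have [Cz <-] := Zz n; have [_ <- _] := hCp n; exists (slice n z).
  have /choice[z hz] : forall n, exists z, C n z /\ p n z = x.
    move=> n; have := Ex n I; have [_ <- _] := hCp n.
    by case=> z Cz <-; exists z.
  (* [w] interleaves the sequences [z n]. The default 0 sits at non-codes, which no [slice]
     reads. *)
  pose w k := if @unpickle (nat * nat)%type k is Some ni then z ni.1 ni.2
              else 0%N.
  have sw n : slice n w = z n by apply/funext => i; rewrite /slice /w pickleK.
  exists w => [n|]; rewrite !sw; have [? e0] := hz 0%N => //.
  by have [? ->] := hz n.
- move=> x V Zx [n _ OV]; have [Cx ex] := Zx n; rewrite -ex => Vx.
  have [_ _ /(_ _ _ Cx OV Vx)[m hm]] := hCp n.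
  have [M hM] := agree_slice n m; exists M => y Zy xy.
  by have [Cy <-] := Zy n; apply: hm => //; exact: hM.
Qed.

(** By continuity, [V] is the union over [m] of the images of the points of [C] whose whole cylinder
    of length [m] is mapped into [V]. Each of these sets of points is closed. *)
Lemma analytic_member O V : analytic O setT -> O V -> analytic O V.
Proof.
move=> [C [p [cC imp cp]]] OV.
pose Cm m := [set x | C x /\ forall y, C y -> agree m x y -> V (p y)].
have -> : V = \bigcup_m (p @` Cm m).
  apply/seteqP; split=> [x Vx|_ [m _ [x [Cx hx] <-]]]; last exact: hx.
  have [z Cz zx] : (p @` C) x by rewrite imp.
  rewrite -zx in Vx *.
  by have [m hm] := cp _ _ Cz OV Vx; exists m => //; exists z.
apply: analytic_bigcup => m; exists (Cm m), p; split=> //.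
- move=> x hx; split=> [|y Cy xy].
    by apply: cC => n; have [y [Cy _] xy] := hx n; exists y.
  have [z [Cz hz] xz] := hx m.
  by apply: hz => //; apply: agree_trans xy; exact: agree_sym.
- move=> x W [Cx _] OW Wx; have [n hn] := cp _ _ Cx OW Wx.
  by exists n => y [Cy _]; exact: hn.
Qed.

Lemma analytic_memberC O V : analytic O setT -> O V -> analytic O (~` V).
Proof.
move=> [C [p [cC imp cp]]] OV.
exists [set x | C x /\ ~ V (p x)], p; split=> //.
- move=> x hx; have Cx : C x.
    by apply: cC => n; have [y [Cy _] xy] := hx n; exists y.
  split=> // Vx; have [m hm] := cp _ _ Cx OV Vx.
  by have [y [Cy nVy] xy] := hx m; exact/nVy/hm.
- apply/seteqP; split=> [_ [x [_ Vx] <-]//|x nVx].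
  have [z Cz zx] : (p @` C) x by rewrite imp.
  by move: nVx; rewrite -zx => nVx; exists z.
- move=> x W [Cx _] OW Wx; have [n hn] := cp _ _ Cx OW Wx.
  by exists n => y [Cy _]; exact: hn.
Qed.

(** The sets that are analytic together with their complement form a sigma-algebra containing [O].
    Since [p] is total, parametrizing the empty set requires a point of [X]; the empty type is
    treated apart. *)
Lemma analytic_sigma O E : hausdorff_family O -> analytic O setT ->
  <<s O >> E -> analytic O E /\ analytic O (~` E).
Proof.
move=> hO aT; have [x0|noX] := pselect (exists x : X, True); last first.
  have e A : A = setT :> set X.
    by apply/seteqP; split=> // x; case: noX; exists x.
  by rewrite (e E) (e (~` _)).
have {x0} [x0 _] := x0.
apply: (smallest_sub (X := [set E | analytic O E /\ analytic O (~` E)])).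
  split=> /=.
  - rewrite setC0; split=> //; exists set0, (fun=> x0); split=> //.
      by move=> x /(_ 0%N)[].
    by rewrite image_set0.
  - by move=> A [aA aAc]; rewrite setTD setCK.
  - move=> A aA; split; first by apply: analytic_bigcup => n; have [] := aA n.
    rewrite setC_bigcup.
    have -> : O = \bigcup_(n in [set: nat]) O.
      by apply/seteqP; split=> [V|V [n _]//]; exists 0%N.
    apply: (analytic_bigcap hO) => [n V|n]; [by []|by have [] := aA n].
by move=> V OV; split; [exact: analytic_member|exact: analytic_memberC].
Qed.

(** * Lusin separation inside a given sigma-algebra *)

Section separation.
Variable D : set (set X).
Hypothesis sD : sigma_algebra setT D.

Let separated (A B : set X) := exists S, [/\ D S, A `<=` S & B `<=` ~` S].

Let DC A : D A -> D (~` A).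
Proof. by case: sD => _ + _; rewrite -setTD; apply. Qed.

Let separated_bigcup (A B : nat -> set X) :
  (forall a b, separated (A a) (B b)) ->
  separated (\bigcup_a A a) (\bigcup_b B b).
Proof.
move=> h; have /choice[S hS] : forall ab : nat * nat, exists S,
  [/\ D S, A ab.1 `<=` S & B ab.2 `<=` ~` S] by case.
have [_ _ DU] := sD.
(* This is the union over [a] of the intersections over [b] of [S (a, b)], written with unions and
   complements only. *)
exists (\bigcup_a ~` \bigcup_b ~` S (a, b)); split.
- apply: (DU) => a; apply: DC; apply: (DU) => b; apply: DC.
  by have [] := hS (a, b).
- move=> x [a _ Ax]; exists a => // -[b _]; apply.
  by have [_ + _] := hS (a, b); exact.
- move=> x [b _ Bx] [a _]; apply; exists b => //.
  by have [_ _] := hS (a, b); exact.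
Qed.

(** If [E1] and [E2] are not separated, successive refinement of cylinders gives two branches along
    which the images are never separated. Some [B] separates the two limit values, and by continuity
    it already separates the images of long enough cylinders; this uses both [B] and its complement
    in [O]. *)
Lemma analytic_separation O E1 E2 : analytic O E1 -> analytic O E2 ->
  (forall x y, E1 x -> E2 y ->
    exists B, [/\ D B, O B, O (~` B), B x & ~ B y]) ->
  exists S, [/\ D S, E1 `<=` S & E2 `<=` ~` S].
Proof.
move=> [C1 [p1 [cC1 imp1 cp1]]] [C2 [p2 [cC2 imp2 cp2]]] sepE.
pose pre (s : seq nat) (x : nat -> nat) := s = mkseq x (size s).
pose A1 s := p1 @` [set x | C1 x /\ pre s x].
pose A2 s := p2 @` [set x | C2 x /\ pre s x].
have preE s x : pre s x -> pre (rcons s (x (size s))) x.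
  by rewrite /pre size_rcons mkseqS => <-.
have AU C (p : _ -> X) (s : seq nat) : p @` [set x | C x /\ pre s x] `<=`
    \bigcup_a (p @` [set x | C x /\ pre (rcons s a) x]).
  move=> _ [x [Cx sx] <-]; exists (x (size s)) => //; exists x => //.
  by split=> //; exact: preE.
apply: contrapT => nsep.
(* [F] extends an inseparable pair of prefixes by one entry each; (0, 0) is a dummy value for
   separable pairs. *)
have /choice[F hF] : forall st : seq nat * seq nat, exists ab : nat * nat,
    ~ separated (A1 st.1) (A2 st.2) ->
    ~ separated (A1 (rcons st.1 ab.1)) (A2 (rcons st.2 ab.2)).
  move=> [s t] /=; have [sst|nst] := pselect (separated (A1 s) (A2 t)).
    by exists (0, 0)%N.
  apply: contrapT => /forallNP h; apply: nst.
  have [a b|S [DS sS tS]] := @separated_bigcup (fun a => A1 (rcons s a))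
                                         (fun b => A2 (rcons t b)).
    by apply: contrapT => nab; apply: (h (a, b)).
  exists S; split=> //; first exact: subset_trans (@AU C1 p1 s) sS.
  exact: subset_trans (@AU C2 p2 t) tS.
pose st m := iter m (fun st => (rcons st.1 (F st).1, rcons st.2 (F st).2))
  ([::], [::]).
pose x i := (F (st i)).1; pose y i := (F (st i)).2.
have stE m : st m = (mkseq x m, mkseq y m).
  by elim: m => [//|m IH]; rewrite !mkseqS /st iterS -/(st m) /x /y IH.
have {hF} nst m : ~ separated (A1 (mkseq x m)) (A2 (mkseq y m)).
  elim: m => [[S [DS sS tS]]|m]; last first.
    by have := hF (st m); rewrite -/(x m) -/(y m) stE !mkseqS; exact.
  apply: nsep; exists S; rewrite -imp1 -imp2; split=> // _ [z Cz <-].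
    by apply: sS; exists z.
  by apply: tS; exists z.
have preP z w m : pre (mkseq z m) w -> agree m z w.
  rewrite /pre size_mkseq => e i im.
  by rewrite -(nth_mkseq 0%N z im) e nth_mkseq.
have [D0 _ _] := sD.
(* Were some prefix of [x] without extension in [C1], the corresponding image would be empty, hence
   separated by [set0]. For [y] the separating set is [setT]. *)
have Cx : C1 x.
  apply: cC1 => m; apply: contrapT => hm; apply: (nst m).
  exists set0; split=> //; last by rewrite setC0.
  by move=> _ [z [Cz /preP xz] <-]; case: hm; exists z.
have Cy : C2 y.
  apply: cC2 => m; apply: contrapT => hm; apply: (nst m).
  exists setT; split=> //; first by rewrite -setC0; exact: DC.
  by move=> _ [z [Cz /preP xz] <-]; case: hm; exists z.
have [||B [DB OB OBc Bx By]] := sepE (p1 x) (p2 y).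
- by rewrite -imp1; exists x.
- by rewrite -imp2; exists y.
have [m1 h1] := cp1 _ _ Cx OB Bx; have [m2 h2] := cp2 _ _ Cy OBc By.
apply: (nst (maxn m1 m2)); exists B; split=> // _ [z [Cz /preP xz] <-].
  by apply: h1 => //; apply: agreeW xz; exact: leq_maxl.
by apply: h2 => //; apply: agreeW xz; exact: leq_maxr.
Qed.

End separation.

(* Blackwell's theorem, when O is the topology of a Souslin space. *)
Lemma separating_sequence_generates O (B : nat -> set X) D :
  hausdorff_family O -> analytic O setT -> (forall n, <<s O >> (B n)) ->
  (forall x y, x <> y -> exists n, B n x /\ ~ B n y \/ B n y /\ ~ B n x) ->
  sigma_algebra setT D -> (forall n, D (B n)) -> <<s O >> `<=` D.
Proof.
move=> hO aT sB sepB sD DB E sE.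
pose O' n := if n is m.+1 then O `|` [set B m; ~` B m] else O.
(* [B n] and its complement are analytic, and on each of them the two added sets are constant, so
   refining costs nothing; the union of the two pieces is the whole space. *)
have aT' n : analytic (O `|` [set B n; ~` B n]) setT.
  have -> : setT = \bigcup_k (if k is 0%N then B n else ~` B n).
    apply/seteqP; split=> // x _; have [Bx|Bx] := pselect (B n x).
      by exists 0%N.
    by exists 1%N.
  have [aB aBc] := analytic_sigma hO aT (sB n).
  by apply: analytic_bigcup => -[|_]; apply: analytic_refine => //;
    [left|right].
have aO' A : analytic O A -> analytic (\bigcup_n O' n) A.
  (* Index 0 carries [A] and index [n.+1] carries the whole space with [B n] made clopen. The fibre
     product then makes every [B n] clopen at once. *)
  move=> aA; have -> : A = \bigcap_n (if n is 0%N then A else setT).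
    apply/seteqP; split=> [x Ax [|n] _ //|x /(_ 0%N I)//].
  apply: (analytic_bigcap hO) => [[|n]|[|n]] //=.
have [/aO' aE /aO' aEc] := analytic_sigma hO aT sE.
have [_ DC _] := sD.
have [|S [DS ES EcS]] := analytic_separation sD aE aEc.
  move=> x y Ex Ey.
  have [n Bn] : exists n, B n x /\ ~ B n y \/ B n y /\ ~ B n x.
    by apply: sepB => xy; apply: Ey; rewrite -xy.
  have OB : (\bigcup_n O' n) (B n) by exists n.+1 => //; right; left.
  have OBc : (\bigcup_n O' n) (~` B n) by exists n.+1 => //; right; right.
  case: Bn => -[Bx By]; [exists (B n)|exists (~` B n)]; split=> //.
  - by rewrite -setTD; exact: DC.
  - by rewrite setCK.
suff -> : E = S by [].
apply/seteqP; split=> // x Sx; apply: contrapT => Ex; exact: EcS Sx.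
Qed.

End analytic_sets.

Local Open Scope ring_scope.

Lemma countable_enumeration (T : Type) (A : set T) : countable A -> A !=set0 ->
  exists u : nat -> T, range u = A.
Proof.
move=> cA A0; have /pfcard_geP[A0'|[f]] := cA.
  by move: A0; rewrite A0' => -[].
exists f; apply/seteqP; split=> [_ [n _ <-]|x Ax]; first exact: funS.
by have [n _ <-] := @surj _ _ _ _ f x Ax; exists n.
Qed.

(** * Souslin spaces as continuous images of closed subsets of the Baire space *)

Section polish_parametrization.
Context {R : realType} {M : metricType R} {X : ptopologicalType}.
Variables (d : nat -> M) (q : M -> X).
Hypothesis complM : complete_metric M.
Hypothesis denseM : forall (y : M) (e : R), 0 < e -> exists n, ball y e (d n).
Hypothesis cq : continuous q.
Hypothesis surjq : range q = [set: X].

Let eps (m : nat) : R := m.+1%:R^-1.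

Let eps_gt0 m : 0 < eps m. Proof. by rewrite invr_gt0. Qed.

Let eps_le m n : (m <= n)%N -> eps n <= eps m.
Proof. by move=> mn; rewrite lef_pV2 ?posrE// ler_nat. Qed.

Let eps_lt (e : R) : 0 < e -> exists m, eps m < e.
Proof.
move=> e0; have := @near_infty_natSinv_lt R (PosNum e0) => -[m _ h].
by exists m; exact: (h m (leqnn m)).
Qed.

Lemma complete_separable_analytic : analytic open [set: X].
Proof.
(* Codes of sequences from the dense set that are Cauchy at a fixed rate, which is a closed
   condition. The factor 2 leaves room for any [z] with [d (z n)] within [eps n] of a given
   point. *)
pose C := [set z : nat -> nat | forall m n, (m <= n)%N ->
             ball (d (z m)) (2 * eps m) (d (z n))].
have /choice[l hl] : forall z, exists l : M, C z -> d \o z @ \oo --> l.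
  move=> z; have [Cz|nCz] := pselect (C z); last by exists (d 0%N).
  have [|l hl] := complM (u := d \o z); last by exists l.
  apply: cauchy_exP => e e0; have [|m hm] := @eps_lt (e / 2).
    by rewrite divr_gt0.
  exists (d (z m)); exists m => // n /= mn.
  by apply: (le_ball _ (Cz _ _ mn)); lra.
have close z m : C z -> ball (l z) (3 * eps m) (d (z m)).
  move=> Cz; have /cvg_ballP/(_ _ (eps_gt0 m))[N _ hN] := hl z Cz.
  have h1 := hN _ (leq_maxl N m); have h2 := Cz _ _ (leq_maxr N m).
  have := ball_triangle h1 (ball_sym h2); apply: le_ball; lra.
exists C, (q \o l); split=> /=.
- move=> x hx m n mn; have [y Cy xy] := hx n.+1.
  by rewrite (xy m) ?ltnS// (xy n) ?ltnS//; exact: Cy.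
- apply/seteqP; split=> // x _; have [y _ <-] : range q x by rewrite surjq.
  have /choice[z hz] : forall n, exists k, ball y (eps n) (d k).
    by move=> n; exact: denseM.
  have Cz : C z.
    move=> m n mn; have := ball_triangle (ball_sym (hz m)) (hz n).
    by apply: le_ball; have := eps_le mn; lra.
  exists z => //; congr q.
  apply: (@cvg_unique M _ (d \o z @ \oo)) => //.
  - exact: metric_hausdorff.
  - exact: hl.
  - apply/cvg_ballP => e e0; have [m hm] := eps_lt e0.
    exists m => // n /= mn; apply: (le_ball _ (hz n)).
    by have := eps_le mn; lra.
- move=> z V Cz oV Vz.
  have : nbhs (l z) (q @^-1` V) by apply: cq; exact: open_nbhs_nbhs.
  move=> /nbhs_ballP[e /= e0 he].
  (* Both limits lie within [3 * eps m] of the common point [d (z m)]. Agreement up to [m.+1] makes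
     entry [m] common. *)
  have [|m hm] := @eps_lt (e / 6); first by rewrite divr_gt0.
  exists m.+1 => w Cw zw; apply: he.
  have h1 := close z m Cz; have := close w m Cw; rewrite -(zw m)// => h2.
  by have := ball_triangle h1 (ball_sym h2); apply: le_ball; lra.
Qed.

End polish_parametrization.

Lemma souslin_analytic (R : realType) (X : ptopologicalType) :
  souslin_space R X -> analytic open [set: X].
Proof.
move=> [_ [Y [h [[[S cS dS] [M [complM [f [g [fK gK cf cg]]]]]] ch surjh]]]].
have [y0 _ _] : range h (point : X) by rewrite surjh.
have S0 : S !=set0.
  by have [|x [_ Sx]] := dS setT _ openT; [exists y0|exists x].
have [u uS] := countable_enumeration cS S0.
apply: (@complete_separable_analytic R M X (g \o u) (h \o f)) => //.
- move=> y e e0.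
  have [||x [bx Sx]] := dS (g @^-1` (ball y e)^°).
  + by exists (f y); rewrite /= fK; exact: nbhsx_ballx.
  + by move/continuousP: cg; apply; exact: open_interior.
  + move: Sx; rewrite -uS => -[n _ unx]; exists n => /=.
    by rewrite unx; exact: interior_subset bx.
- by move=> y; apply: continuous_comp; [exact: cf|exact: ch].
- apply/seteqP; split=> // x _; have [y _ <-] : range h x by rewrite surjh.
  by exists (g y) => //=; rewrite gK.
Qed.

Lemma hausdorff_open (X : topologicalType) :
  hausdorff_space X -> hausdorff_family (@open X).
Proof.
rewrite open_hausdorff => hX x y /eqP /hX[[U V] /= [xU yV] [oU oV UV]].
exists U, V; split=> //; rewrite ?inE// in xU yV *.
by move=> z Uz Vz; move/eqP: UV; rewrite -subset0 => /(_ z); apply.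
Qed.

(** * Bounded pointwise closure *)

(* bp for bounded pointwise *)
Inductive bp_span {R : realType} {T : Type} (G : set (T -> R)) :
    (T -> R) -> Prop :=
| bp_cst c : bp_span G (fun=> c)
| bp_gen u : G u -> bp_span G u
| bp_add u v : bp_span G u -> bp_span G v -> bp_span G (fun x => u x + v x)
| bp_scale c u : bp_span G u -> bp_span G (fun x => c * u x)
| bp_lim (s : nat -> T -> R) u M :
    (forall n, bp_span G (s n)) -> (forall n x, `|s n x| <= M) ->
    (forall x, s n x @[n --> \oo] --> u x) -> bp_span G u.

(** * Polynomial approximation of the absolute value *)

Section abs_approximation.
Context {R : realType}.
Implicit Types t : R.

(** The classical iteration for the square root of [t ^+ 2]. Every term is a polynomial in [t], so
    it stays inside an algebra of functions. *)
Fixpoint abs_approx t n : R :=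
  if n is m.+1 then
    let p := abs_approx t m in p + 2^-1 * (t ^+ 2 - p ^+ 2)
  else 0.

(** With [a] for the absolute value and [p] for the current term, the next error is
    [(a - p) * (1 - (a + p) / 2)], and [p >= 0] bounds the second factor by [1 - a / 2]. *)
Lemma abs_approx_bounds t n : `|t| <= 1 ->
  0 <= abs_approx t n <= `|t| /\
  `|t| - abs_approx t n <= `|t| * (1 - `|t| / 2) ^+ n.
Proof.
move=> t1; elim: n => [|n].
  by rewrite /= lexx normr_ge0 subr0 expr0 mulr1.
rewrite exprS /= -(real_normK (num_real t)).
move: (abs_approx t n) (_ ^+ n) => p e; have := normr_ge0 t.
move: `|t| t1 => a a1 a0 [/andP[p0 pa] ae].
have pos : 0 <= (a - p) * (a + p) by rewrite mulr_ge0//; lra.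
have pos' : 0 <= (a - p) * (2 - (a + p)) by rewrite mulr_ge0//; lra.
have ap : 0 <= (a - p) * p by rewrite mulr_ge0//; lra.
have ae' : (a - p) * (1 - a / 2) <= a * e * (1 - a / 2).
  by rewrite ler_wpM2r//; lra.
split; first by apply/andP; split; nra.
have -> : a * ((1 - a / 2) * e) = a * e * (1 - a / 2) by ring.
by apply: le_trans ae'; nra.
Qed.

Lemma abs_approx_cvg t : `|t| <= 1 -> abs_approx t n @[n --> \oo] --> `|t|.
Proof.
(* At [t = 0] the ratio [1 - |t| / 2] equals 1 and gives no decay, but there all the terms
   vanish. *)
move=> t1; have [t0|t0] := eqVneq t 0.
  apply: cvg_near_cst; apply: nearW => n.
  have [/andP[p0 pt] _] := abs_approx_bounds n t1.
  by rewrite t0 normr0 in p0 pt *; apply/eqP; rewrite eq_le pt p0.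
have tgt0 : 0 < `|t| by rewrite normr_gt0.
apply: (@squeeze_cvgr _ _ _ _ (fun n => `|t| - `|t| * (1 - `|t| / 2) ^+ n)
  (fun=> `|t|)) => //; last exact: cvg_cst.
  apply: nearW => n; have [/andP[p0 pt] h] := abs_approx_bounds n t1.
  by rewrite pt andbT; lra.
suff : `|t| - `|t| * (1 - `|t| / 2) ^+ n @[n --> \oo] --> `|t| - `|t| * 0.
  by rewrite mulr0 subr0.
apply: cvgB; first exact: cvg_cst.
apply: cvgMl_tmp; apply: cvg_expr; rewrite ger0_norm; lra.
Qed.

End abs_approximation.

(** * The bounded pointwise closure as an algebra, and its sigma-algebra of sets *)

Section bp_algebra.
Context {R : realType} {T : Type}.
Variable G : set (T -> R).
Hypothesis boundedG : forall u, G u -> exists M, forall x, `|u x| <= M.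
Hypothesis mulG : forall u v, G u -> G v -> bp_span G (fun x => u x * v x).
Implicit Types (u v : T -> R) (A : set T).

Lemma bp_bounded u : bp_span G u -> exists2 M, 0 < M & forall x, `|u x| <= M.
Proof.
have wlogM v : (exists M, forall x, `|v x| <= M) ->
    exists2 M, 0 < M & forall x, `|v x| <= M.
  move=> [M hM]; exists (`|M| + 1); first by rewrite ltr_wpDl.
  by move=> x; rewrite (le_trans (hM x))// (le_trans (ler_norm M))// lerDl.
move=> bu; apply: wlogM; elim: bu => {u}.
- by move=> c; exists `|c|.
- by move=> u /boundedG.
- move=> u v _ [M hM] _ [N hN]; exists (M + N) => x.
  by rewrite (le_trans (ler_normD _ _))// lerD.
- by move=> c u _ [M hM]; exists (`|c| * M) => x; rewrite normrM ler_wpM2l.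
- move=> s u M _ _ hM cu; exists M => x.
  apply: (cvgr_to_le (cvg_norm (cu x))).
  by apply: nearW => n; exact: hM.
Qed.

Lemma bp_eq u v : u =1 v -> bp_span G u -> bp_span G v.
Proof. by move=> /funext ->. Qed.

Let bp_mul_closed v :
  (forall u, G u -> bp_span G (fun x => u x * v x)) -> bp_span G v ->
  forall u, bp_span G u -> bp_span G (fun x => u x * v x).
Proof.
move=> hG bv u; elim => {u}.
- by move=> c; exact: bp_scale.
- exact: hG.
- move=> u1 u2 _ b1 _ b2; apply: bp_eq (bp_add b1 b2) => x.
  by rewrite mulrDl.
- move=> c u _ bu; apply: bp_eq (bp_scale c bu) => x.
  by rewrite mulrA.
- move=> s u M _ bs sM su; have [N N0 hN] := bp_bounded bv.
  apply: (@bp_lim _ _ _ (fun n x => s n x * v x) _ (M * N)) => // [n x|x].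
    by rewrite normrM ler_pM.
  by apply: cvgMr_tmp; exact: su.
Qed.

(** Two inductions, each with one factor fixed: the first reduces [u] to a generator, the second
    reduces [v], leaving [mulG]. *)
Lemma bp_mul u v : bp_span G u -> bp_span G v ->
  bp_span G (fun x => u x * v x).
Proof.
move=> bu bv; move: u bu; apply: bp_mul_closed => // u Gu.
apply: (@bp_eq (fun x => v x * u x)) => [x|]; first by rewrite mulrC.
apply: bp_mul_closed bv; last exact: bp_gen.
by move=> w Gw; exact: mulG.
Qed.

Lemma bp_sub u v : bp_span G u -> bp_span G v ->
  bp_span G (fun x => u x - v x).
Proof.
move=> bu bv; apply: bp_eq (bp_add bu (bp_scale (-1) bv)) => x.
by rewrite mulN1r.
Qed.

Lemma bp_exp n u : bp_span G u -> bp_span G (fun x => u x ^+ n).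
Proof.
move=> bu; elim: n => [|n IH]; first exact: bp_cst.
by apply: bp_eq (bp_mul bu IH) => x; rewrite exprS.
Qed.

Lemma bp_sum n (s : nat -> T -> R) : (forall k, bp_span G (s k)) ->
  bp_span G (fun x => \sum_(k < n) s k x).
Proof.
move=> bs; elim: n => [|n IH].
  by apply: bp_eq (bp_cst G 0) => x; rewrite big_ord0.
by apply: bp_eq (bp_add IH (bs n)) => x; rewrite big_ord_recr.
Qed.

Lemma bp_prod n (s : nat -> T -> R) : (forall k, bp_span G (s k)) ->
  bp_span G (fun x => \prod_(k < n) s k x).
Proof.
move=> bs; elim: n => [|n IH].
  by apply: bp_eq (bp_cst G 1) => x; rewrite big_ord0.
by apply: bp_eq (bp_mul IH (bs n)) => x; rewrite big_ord_recr.
Qed.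

Lemma bp_abs u : (forall x, `|u x| <= 1) -> bp_span G u ->
  bp_span G (fun x => `|u x|).
Proof.
move=> u1 bu.
apply: (@bp_lim _ _ _ (fun n x => abs_approx (u x) n) _ 1) => [n|n x|x].
- elim: n => [|n IH] /=; first exact: bp_cst.
  by apply: bp_add => //; apply: bp_scale; apply: bp_sub; exact: bp_exp.
- have [/andP[p0 pu] _] := abs_approx_bounds n (u1 x).
  by rewrite ger0_norm// (le_trans pu).
- exact: abs_approx_cvg.
Qed.

Lemma bp_indic_gt0 u : bp_span G u -> bp_span G (\1_[set x | 0 < u x]).
Proof.
move=> bu; have [K K0 uK] := bp_bounded bu.
pose v x := K^-1 * u x.
have v1 x : `|v x| <= 1.
  by rewrite normrM gtr0_norm ?invr_gt0// ler_pdivrMl// mulr1.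
have bv : bp_span G v by exact: bp_scale.
(* The positive part of [u / K]. It takes values in [0, 1] and is positive exactly where [u] is, so
   [1 - (1 - w) ^+ n] tends to the indicator. *)
pose w x := 2^-1 * (v x + `|v x|).
have bw : bp_span G w by apply: bp_scale; apply: bp_add => //; exact: bp_abs.
have w01 x : 0 <= w x <= 1.
  have := v1 x; rewrite /w.
  by case: (ger0P (v x)) => ? ?; apply/andP; split; lra.
apply: (@bp_lim _ _ _ (fun n x => 1 - (1 - w x) ^+ n) _ 1) => [n|n x|x].
- apply: bp_sub; first exact: bp_cst.
  by apply: bp_exp; apply: bp_sub => //; exact: bp_cst.
- have /andP[w0 w1] := w01 x.
  have : 0 <= (1 - w x) ^+ n <= 1.
    by rewrite exprn_ge0 ?subr_ge0// exprn_ile1 ?subr_ge0// gerBl.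
  by move=> /andP[? ?]; rewrite ger0_norm; lra.
- have /andP[w0 w1] := w01 x; rewrite indicE.
  have [ux|ux] := ltrP 0 (u x).
    have wv : 0 < w x.
      have vx : 0 < v x by rewrite mulr_gt0 ?invr_gt0.
      by rewrite /w gtr0_norm//; lra.
    suff : 1 - (1 - w x) ^+ n @[n --> \oo] --> (1 - 0 : R).
      by rewrite subr0 mem_set.
    apply: cvgB; first exact: cvg_cst.
    by apply: cvg_expr; rewrite ger0_norm; lra.
  have wv : w x = 0.
    have vx : v x <= 0 by rewrite mulr_ge0_le0// invr_ge0 ltW.
    by rewrite /w ler0_norm//; lra.
  rewrite memNset/=; last by apply/negP; rewrite -leNgt.
  by apply: cvg_near_cst; apply: nearW => n; rewrite wv subr0 expr1n subrr.
Qed.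

Lemma bp_indicC A : bp_span G (\1_A) -> bp_span G (\1_(~` A)).
Proof.
move=> bA; apply: bp_eq (bp_sub (bp_cst G 1) bA) => x.
by rewrite !indicE in_setC; case: (x \in A); rewrite ?subrr ?subr0.
Qed.

Lemma bp_indic_sigma_algebra :
  sigma_algebra setT [set A | bp_span G (\1_A)].
Proof.
split=> /=.
- by apply: bp_eq (bp_cst G 0) => x; rewrite indicE in_set0.
- by move=> A bA; rewrite setTD; exact: bp_indicC.
- move=> A bA.
  (* The [n]-th function is the indicator of the union of the first [n] sets; at each point the
     sequence is eventually constant. *)
  apply: (@bp_lim _ _ _ (fun n x => 1 - \prod_(k < n) \1_(~` A k) x) _ 1).
  + move=> n; apply: bp_sub; first exact: bp_cst.
    by apply: (bp_prod n (s := fun k => \1_(~` A k))) => k; exact: bp_indicC.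
  + move=> n x; have : 0 <= \prod_(k < n) (\1_(~` A k) x : R) <= 1.
      rewrite prodr_ge0//= prodr_ile1// => k _.
      by rewrite indicE; case: (x \in _); rewrite ?lexx ?ler01.
    by move=> /andP[? ?]; rewrite ger0_norm; lra.
  + move=> x; rewrite indicE; have [[k _ Ak]|nA] := pselect ((\bigcup_k A k) x).
      rewrite mem_set; last by exists k.
      apply: cvg_near_cst; exists k.+1 => // n /= kn.
      by rewrite (bigD1 (Ordinal kn))//= indicE memNset ?mul0r ?subr0//; apply.
    rewrite memNset//; apply: cvg_near_cst; apply: nearW => n.
    rewrite big1 ?subrr// => k _; rewrite indicE mem_set// => Ak.
    by apply: nA; exists k.
Qed.

End bp_algebra.

(** * Weighted integrals *)

Lemma measurable_set_gt d (T : measurableType d) (R : realType) (a : R)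
  (u : T -> R) : measurable_fun setT u -> measurable [set x | a < u x].
Proof.
move=> mu; rewrite -[X in measurable X]setTI.
by apply: measurable_fun_ltr => //; exact: measurable_cst.
Qed.

Section weighted_integrals.
Context d (T : measurableType d) (R : realType).
Variables (G : set (T -> R)) (w : T -> R).
Hypothesis boundedG : forall u, G u -> exists M, forall x, `|u x| <= M.
Hypothesis measurableG : forall u, G u -> measurable_fun setT u.
Hypothesis mw : measurable_fun setT w.
Hypothesis w0 : forall x, 0 <= w x.
Implicit Types mu : {measure set T -> \bar R}.

Lemma bp_measurable u : bp_span G u -> measurable_fun setT u.
Proof.
elim=> {u}.
- by move=> c; exact: measurable_cst.
- exact: measurableG.
- by move=> u v _ mu _ mv; exact: measurable_funD.
- by move=> c u _ mu; apply: measurable_funM => //; exact: measurable_cst.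
- by move=> s u M _ ms _ su; apply: (measurable_fun_cvg ms) => x _; exact: su.
Qed.

Lemma bp_integrable mu u : mu.-integrable setT (EFin \o w) -> bp_span G u ->
  mu.-integrable setT (fun x => (u x * w x)%:E).
Proof.
move=> iw bu; have [M M0 uM] := bp_bounded boundedG bu.
have iMw : mu.-integrable setT (fun x => (M * w x)%:E).
  exact: (integrableZl measurableT M iw).
apply: le_integrable iMw => //.
  by apply/measurable_EFinP; apply: measurable_funM => //; exact: bp_measurable.
move=> x _ /=; rewrite lee_fin !normrM ler_wpM2r// (gtr0_norm M0).
exact: uM.
Qed.

Variables mu1 mu2 : {measure set T -> \bar R}.
Hypothesis iw1 : mu1.-integrable setT (EFin \o w).
Hypothesis iw2 : mu2.-integrable setT (EFin \o w).
Hypothesis eqw : (\int[mu1]_x (w x)%:E = \int[mu2]_x (w x)%:E)%E.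
Hypothesis eqG : forall u, G u ->
  (\int[mu1]_x (u x * w x)%:E = \int[mu2]_x (u x * w x)%:E)%E.

(** Induction on the closure. The measures may be infinite, so integrability comes from the weight;
    in the limit case [M * w] dominates. *)
Lemma bp_integral_eq u : bp_span G u ->
  (\int[mu1]_x (u x * w x)%:E = \int[mu2]_x (u x * w x)%:E)%E.
Proof.
elim=> {u}.
- move=> c; under eq_integral do rewrite EFinM.
  under [RHS]eq_integral do rewrite EFinM.
  by rewrite !integralZl// eqw.
- exact: eqG.
- move=> u v bu IHu bv IHv.
  under eq_integral do rewrite mulrDl EFinD.
  under [RHS]eq_integral do rewrite mulrDl EFinD.
  by rewrite !integralD_EFin ?IHu ?IHv//; exact: bp_integrable.
- move=> c u bu IHu.
  under eq_integral do rewrite -mulrA EFinM.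
  under [RHS]eq_integral do rewrite -mulrA EFinM.
  by rewrite !integralZl ?IHu//; exact: bp_integrable.
- move=> s u M bs IH sM su.
  have cvgs mu : mu.-integrable setT (EFin \o w) ->
      (\int[mu]_x (s n x * w x)%:E)%E @[n --> \oo] -->
      (\int[mu]_x (u x * w x)%:E)%E.
    move=> iw; have [] // := @dominated_convergence _ _ _ mu setT measurableT
      (fun n x => (s n x * w x)%:E) (fun x => (u x * w x)%:E)
      (fun x => (M * w x)%:E).
    + move=> n; apply/measurable_EFinP; apply: measurable_funM => //.
      exact: bp_measurable.
    + apply/measurable_EFinP; apply: measurable_funM => //.
      by apply: (measurable_fun_cvg (fun n => bp_measurable (bs n))) => x _.
    + apply: aeW => x _; apply: cvg_EFin; first exact: nearW.
      by apply: cvgMr_tmp; exact: su.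
    + exact: (integrableZl measurableT M iw).
    + apply: aeW => x n _ /=; rewrite lee_fin normrM (ger0_norm (w0 x)).
      by rewrite ler_wpM2r.
  rewrite -(cvg_lim (@ereal_hausdorff R) (cvgs mu1 iw1)).
  by under eq_fun do rewrite IH; apply: cvg_lim (cvgs mu2 iw2).
Qed.

Hypothesis mulG : forall u v, G u -> G v -> bp_span G (fun x => u x * v x).
Hypothesis bw : bp_span G w.

(* With s = w / K in [0, 1], the weight is divided out by
   1_B (1 - (1 - s)^n) = (1_B / K) (\sum_(k < n) (1 - s)^k) w, which increases
   to the indicator of B `&` [set x | 0 < w x]. *)
Lemma bp_measure_eq (B : set T) : measurable B -> bp_span G (\1_B) ->
  mu1 (B `&` [set x | 0 < w x]) = mu2 (B `&` [set x | 0 < w x]).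
Proof.
move=> mB bB; have [K K0 wK] := bp_bounded boundedG bw.
pose s x := K^-1 * w x.
have bs : bp_span G s by exact: bp_scale.
have s01 x : 0 <= s x <= 1.
  rewrite mulr_ge0 ?invr_ge0 ?(ltW K0)//= ler_pdivrMl// mulr1.
  by rewrite (le_trans (ler_norm _)).
have b1s : bp_span G (fun x => 1 - s x).
  by apply: bp_sub => //; exact: bp_cst.
pose g n x := \1_B x * (1 - (1 - s x) ^+ n).
pose u n x := K^-1 * (\1_B x * \sum_(k < n) (1 - s x) ^+ k).
have gu n x : g n x = u n x * w x.
  rewrite /g /u -{1}(expr1n _ n) subrXX subKr.
  under eq_bigr do rewrite expr1n mul1r.
  by rewrite /s; ring.
have bu n : bp_span G (u n).
  apply: bp_scale; apply: bp_mul => //.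
  by apply: (bp_sum n (s := fun k x => (1 - s x) ^+ k)) => k; exact: bp_exp.
have ge1s n x : 0 <= (1 - s x) ^+ n <= 1.
  have /andP[? ?] := s01 x.
  by rewrite exprn_ge0 ?subr_ge0// exprn_ile1 ?subr_ge0// gerBl.
have g0 n x : 0 <= g n x.
  by rewrite mulr_ge0// subr_ge0; have /andP[] := ge1s n x.
pose P := B `&` [set x | 0 < w x].
have mP : measurable P.
  by apply: measurableI => //; exact: measurable_set_gt.
(* The measure of [P] may be infinite, hence monotone rather than dominated convergence. *)
have cvgg mu : (\int[mu]_x (g n x)%:E)%E @[n --> \oo] --> mu P.
  rewrite -(setIT P) -integral_indic//.
  have -> : (\int[mu]_(x in setT) (\1_P x)%:E =
      \int[mu]_(x in setT) limn (fun n => (g n x)%:E))%E.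
    apply: eq_integral => x _; apply/esym/cvg_lim => //.
    apply: cvg_EFin; first exact: nearW.
    rewrite /= /g indicI; apply: cvgMl_tmp.
    have /andP[? ?] := s01 x; rewrite indicE.
    have [wx|wx] := ltrP 0 (w x).
      have sx : 0 < s x by rewrite mulr_gt0 ?invr_gt0.
      rewrite mem_set//=.
      suff : 1 - (1 - s x) ^+ k @[k --> \oo] --> (1 - 0 : R) by rewrite subr0.
      apply: cvgB; first exact: cvg_cst.
      by apply: cvg_expr; rewrite ger0_norm; lra.
    have sx : s x = 0.
      by rewrite /s (le_anti (y := 0) (x := w x)) ?mulr0// wx w0.
    rewrite memNset/=; last by apply/negP; rewrite -leNgt.
    by apply: cvg_near_cst; apply: nearW => k; rewrite sx subr0 expr1n subrr.
  apply: cvg_monotone_convergence => //.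
  - move=> n; apply/measurable_EFinP.
    have -> : g n = fun x => u n x * w x by apply/funext => x.
    by apply: measurable_funM => //; exact: bp_measurable.
  - by move=> n x _; rewrite lee_fin.
  - move=> x _ m n mn; rewrite lee_fin ler_wpM2l// lerB//.
    have /andP[? ?] := s01 x.
    by rewrite ler_wiXn2l// ?subr_ge0// gerBl.
have eqg n : (\int[mu1]_x (g n x)%:E = \int[mu2]_x (g n x)%:E)%E.
  under eq_integral do rewrite gu.
  by rewrite bp_integral_eq//; apply: eq_integral => x _; rewrite gu.
rewrite -/P -(cvg_lim (@ereal_hausdorff R) (cvgg mu1)).
by under eq_fun do rewrite eqg; apply: cvg_lim (cvgg mu2).
Qed.

End weighted_integrals.

(** * Separation of measures *)

Section complex_parts.
Context {R : realType}.
Implicit Types z : R[i].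

Definition part (b : bool) z : R := if b then complex.Im z else complex.Re z.

Lemma part_cmodulus b z : `|part b z| <= cmodulus z.
Proof.
case: z => x y; rewrite /cmodulus /=; case: b => /=;
  by rewrite -sqrtr_sqr ler_wsqrtr// ?lerDl ?lerDr sqr_ge0.
Qed.

Lemma partB b z w : part b (z - w) = part b z - part b w.
Proof. by case: z w b => [x y] [x' y'] []. Qed.

(** [part b] is 1-Lipschitz for the modulus, so the ball of radius [part b z - a] around [z] stays
    in the set. *)
Lemma open_part_gt b (a : R) : open [set z : (R[i])^o | a < part b z].
Proof.
rewrite openE => z /= az; apply/nbhs_ballP; exists (part b z - a)%:C%C => /=.
  by rewrite ltcR subr_gt0.
move=> w; rewrite /ball/= normc_def ltcR => zw.
have := part_cmodulus b (z - w); rewrite partB.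
have -> : cmodulus (z - w) =
    Num.sqrt (complex.Re (z - w) ^+ 2 + complex.Im (z - w) ^+ 2).
  by case: (z - w).
by have := ler_norm (part b z - part b w); lra.
Qed.

Lemma measurable_part b :
  measurable_fun setT (part b : borelType (R[i])^o -> R).
Proof.
apply: (measurability _ (RGenOInfty.measurableE R)).
move=> _ [_ [a ->] <-]; rewrite setTI; apply: sub_sigma_algebra.
have -> : part b @^-1` `]a, +oo[ = [set z | a < part b z].
  by apply/seteqP; split=> z /=; rewrite in_itv/= andbT.
exact: open_part_gt.
Qed.

End complex_parts.

Section separating.
Context {R : realType} {X : ptopologicalType}.
Variable F : set (X -> R[i]).
Hypothesis souslinX : souslin_space R X.
Hypothesis countableF : countable F.
Hypothesis boundedF : forall f, F f -> cbounded f.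
Hypothesis measurableF : forall f, F f -> borel_measurable f.
Hypothesis mulF : mul_closed F.
Hypothesis conjF : conj_closed F.
Hypothesis sepF : separates_points F.
Hypothesis nonvanishF : vanishes_nowhere F.

Let parts : set (borelType X -> R) :=
  [set u | exists2 f, F f & exists b, u = fun x => part b (f x)].

Let parts_F f b : F f -> parts (fun x => part b (f x)).
Proof. by move=> Ff; exists f => //; exists b. Qed.

Let bounded_parts u : parts u -> exists M, forall x, `|u x| <= M.
Proof.
move=> [f Ff [b ->]]; have [M fM] := boundedF Ff; exists M => x.
exact: le_trans (part_cmodulus _ _) (fM x).
Qed.

Let measurable_parts u : parts u -> measurable_fun setT u.
Proof.
move=> [f Ff [b ->]].
exact: measurableT_comp (measurable_part b) (measurableF Ff).
Qed.

(** Each product of a part of [f] with a part of [g] is, up to sign, half the sum or difference of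
    the same part of [f * g] and of [f] times the conjugate of [g]. *)
Let mul_parts u v : parts u -> parts v -> bp_span parts (fun x => u x * v x).
Proof.
have bp_part f b : F f -> bp_span parts (fun x => part b (f x)).
  by move=> Ff; apply: bp_gen; exact: parts_F.
move=> [f Ff [b ->]] [g Fg [c ->]].
have Fcg := conjF Fg.
have Ffg := mulF Ff Fg; have Ffcg := mulF Ff Fcg.
have Re_Im a : bp_span parts (fun x => part a (f x * g x)) by exact: bp_part.
have Re_ImC a : bp_span parts (fun x => part a (f x * (g x)^*%C)).
  exact: bp_part Ffcg.
have bpD a := bp_add (Re_Im a) (Re_ImC a).
have bpB a := bp_sub (Re_Im a) (Re_ImC a).
case: b c => [] [].
- apply: bp_eq (bp_scale (- 2^-1) (bpB false)) => x.
  by case: (f x) (g x) => [? ?] [? ?] /=; field.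
- apply: bp_eq (bp_scale 2^-1 (bpD true)) => x.
  by case: (f x) (g x) => [? ?] [? ?] /=; field.
- apply: bp_eq (bp_scale 2^-1 (bpB true)) => x.
  by case: (f x) (g x) => [? ?] [? ?] /=; field.
- apply: bp_eq (bp_scale 2^-1 (bpD false)) => x.
  by case: (f x) (g x) => [? ?] [? ?] /=; field.
Qed.

(** Blackwell's theorem applied to the sets where a part of a member of [F] exceeds a rational. They
    are countably many, Borel, and separate points because [F] does. *)
Let bp_indic_borel (A : set (borelType X)) :
  measurable A -> bp_span parts (\1_A).
Proof.
have [u uF] : exists u : nat -> X -> R[i], range u = F.
  apply: countable_enumeration => //.
  by have [f Ff _] := nonvanishF point; exists f.
have Fu n : F (u n) by rewrite -uF; exists n.
pose half (t : nat * rat * bool) : set X :=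
  [set x | ratr t.1.2 < part t.2 (u t.1.1 x)].
(* Non-codes yield [set0], which lies in both sigma-algebras. *)
pose B k : set X := if unpickle k is Some t then half t else set0.
have halfE t : half t =
    [set x | 0 < part t.2 (u t.1.1 x) - (cst (ratr t.1.2) : X -> R) x].
  by apply/seteqP; split=> x; rewrite /half/= subr_gt0.
have mhalf t : <<s open >> (half t).
  apply: (@measurable_set_gt _ (borelType X)).
  by apply: measurable_parts; exact: parts_F.
have bphalf t : bp_span parts (\1_(half t)).
  rewrite halfE; apply: bp_indic_gt0 => //.
  by apply: bp_sub; [exact/bp_gen/parts_F|exact: bp_cst].
have sD := @bp_indic_sigma_algebra R X parts bounded_parts mul_parts.
have [sD0 _ _] := sD.
move=> mA.
apply: (separating_sequence_generates (O := open) (B := B) _ _ _ _ sD) => //.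
- by apply: hausdorff_open; case: souslinX.
- exact: souslin_analytic souslinX.
- move=> n; rewrite /B; case: (unpickle n) => [t|]; first exact: mhalf.
  exact: (@measurable0 _ (borelType X)).
- move=> x y /sepF [f + fxy]; rewrite -uF => -[n _ unf].
  have [b fbxy] : exists b, part b (f x) != part b (f y).
    apply: contrapT => /forallNP h; apply: fxy.
    have /negP/negPn/eqP := h true; have /negP/negPn/eqP := h false.
    by case: (f x) (f y) => [? ?] [? ?] /= -> ->.
  have sep z1 z2 : part b (f z1) < part b (f z2) ->
      exists k, B k z2 /\ ~ B k z1.
    move=> /rat_in_itvoo [r]; rewrite in_itv/= => /andP[r1 r2].
    exists (pickle (n, r, b)); rewrite /B pickleK /half/= unf; split=> //.
    by apply/negP; rewrite -leNgt ltW.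
  move: fbxy; rewrite neq_lt => /orP[/sep[k h]|/sep[k h]]; exists k.
    by right.
  by left.
- move=> n; rewrite /B; case: (unpickle n) => [t|]; first exact: bphalf.
  exact: sD0.
Qed.

Let integrable_part mu f b : measures_of F mu -> F f ->
  mu.-integrable setT (fun x => (part b (f x))%:E).
Proof.
move=> Fmu Ff; apply/integrableP; split.
  by apply/measurable_EFinP; apply: measurable_parts; exact: parts_F.
apply: le_lt_trans (Fmu _ Ff); apply: ge0_le_integral => //.
- apply: measurableT_comp => //; apply/measurable_EFinP.
  by apply: measurable_parts; exact: parts_F.
- apply/measurable_EFinP.
  have -> : (fun x => cmodulus (f x)) =
      Num.sqrt \o (fun x => part false (f x) ^+ 2 + part true (f x) ^+ 2).
    by apply/funext => x /=; case: (f x).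
  apply: measurableT_comp.
    by apply: continuous_measurable_fun; exact: sqrt_continuous.
  by apply: measurable_funD; apply: measurable_funX; apply: measurable_parts;
    exact: parts_F.
- by move=> x _; rewrite lee_fin part_cmodulus.
Qed.

Variables mu1 mu2 : {measure set (borelType X) -> \bar R}.
Hypothesis Fmu1 : measures_of F mu1.
Hypothesis Fmu2 : measures_of F mu2.
Hypothesis eqF : forall f, F f -> cintegral mu1 f = cintegral mu2 f.

(** [cintegral] records only the real values of the integrals; integrability makes these determine
    the extended ones. *)
Let integral_part_eq f b : F f ->
  (\int[mu1]_x (part b (f x))%:E = \int[mu2]_x (part b (f x))%:E)%E.
Proof.
move=> Ff; rewrite -[LHS]fineK; last first.
  by apply: integrable_fin_num => //; exact: integrable_part.
rewrite -[RHS]fineK; last first.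
  by apply: integrable_fin_num => //; exact: integrable_part.
by have [re im] := eqF Ff; congr EFin; case: b.
Qed.

Let normsqE (f : X -> R[i]) x :
  part false (f x * (f x)^*%C) = part false (f x) ^+ 2 + part true (f x) ^+ 2.
Proof. by case: (f x) => ? ? /=; ring. Qed.

Let supportE (f : X -> R[i]) :
  [set x | f x <> 0] = [set x | 0 < part false (f x * (f x)^*%C)].
Proof.
apply/seteqP; split=> x; rewrite /mkset normsqE.
  move=> fx; rewrite lt_neqAle eq_sym addr_ge0 ?sqr_ge0// andbT.
  apply/negP; rewrite paddr_eq0 ?sqr_ge0// !sqrf_eq0 => /andP[].
  move: fx; case: (f x) => a b /= fx /eqP a0 /eqP b0.
  by apply: fx; rewrite a0 b0.
by move=> + fx; rewrite fx /= expr0n/= addr0 ltxx.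
Qed.

Let measure_eq_support f (A : set (borelType X)) : F f -> measurable A ->
  mu1 (A `&` [set x | f x <> 0]) = mu2 (A `&` [set x | f x <> 0]).
Proof.
move=> Ff mA; pose w x := part false (f x * (f x)^*%C).
have Fw : F (fun x => f x * (f x)^*%C) by apply: mulF => //; exact: conjF.
rewrite supportE.
apply: (@bp_measure_eq _ _ _ parts w) => //.
- by apply: measurable_parts; exact: parts_F.
- by move=> x; rewrite /w normsqE addr_ge0 ?sqr_ge0.
- exact: integrable_part Fmu1 Fw.
- exact: integrable_part Fmu2 Fw.
- exact: integral_part_eq false Fw.
- move=> u [g Fg [b ->]].
  (* The weight [w] is the squared modulus of [f], which is real, so it passes inside [part]; the
     product then belongs to [F]. *)
  have e x : part b (g x) * w x = part b (g x * (f x * (f x)^*%C)).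
    by rewrite /w; case: b (f x) (g x) => [] [? ?] [? ?] /=; ring.
  under eq_integral do rewrite e; under [RHS]eq_integral do rewrite e.
  by apply: integral_part_eq; exact: mulF.
- by apply: bp_gen; exact: parts_F.
- exact: bp_indic_borel.
Qed.

(** The supports of an enumeration of [F] cover the space. Cutting [A] into disjoint pieces, each
    inside one support, reduces the claim to [measure_eq_support] by countable additivity. *)
Lemma borel_measure_eq (A : set (borelType X)) : measurable A -> mu1 A = mu2 A.
Proof.
move=> mA; have [u uF] : exists u : nat -> X -> R[i], range u = F.
  apply: countable_enumeration => //.
  by have [f Ff _] := nonvanishF point; exists f.
have Fu n : F (u n) by rewrite -uF; exists n.
pose P n : set (borelType X) := [set x | u n x <> 0].
have mP n : measurable (P n).
  rewrite /P supportE; apply: measurable_set_gt.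
  apply: measurable_parts; apply: (@parts_F (fun x => u n x * (u n x)^*%C)).
  by apply: mulF => //; exact: conjF.
have AE : A = \bigcup_n seqDU (fun n => A `&` P n) n.
  rewrite -seqDU_bigcup_eq -setI_bigcupr; apply/esym/setIidPl => x _.
  have [f + fx] := nonvanishF x; rewrite -uF => -[n _ unf].
  by exists n => //; rewrite /P/= unf.
have mD n : measurable (seqDU (fun n => A `&` P n) n).
  apply: measurableD; first exact: measurableI.
  by apply: bigsetU_measurable => k _; exact: measurableI.
have mU : measurable (\bigcup_n seqDU (fun n => A `&` P n) n) by rewrite -AE.
have tD := @trivIset_seqDU _ (fun n => A `&` P n).
rewrite AE !measure_semi_bigcup//.
apply: eq_eseriesr => n _.
have -> : seqDU (fun n => A `&` P n) n = seqDU (fun n => A `&` P n) n `&` P n.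
  by apply/esym/setIidPl => x [[_]].
exact: measure_eq_support.
Qed.

End separating.

Theorem theorem2p7 (R : realType) (X : ptopologicalType) (F : set (X -> R[i]))
    (souslinX : souslin_space R X)
    (countableF : countable F)
    (boundedF : forall f, F f -> cbounded f)
    (measurableF : forall f, F f -> borel_measurable f)
    (mulF : mul_closed F)
    (conjF : conj_closed F)
    (sepF : separates_points F)
    (nonvanishF : vanishes_nowhere F) :
  separating_for F (measures_of F).
Proof.
by move=> mu1 mu2 Fmu1 Fmu2 eqF A; exact: borel_measure_eq eqF A.
Qed.
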